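(* Let $n\ge2$, $m\ge2$, $0<r<n$ be integers, $C>0$, $T$ a positive integer with $\frac{1}{2nrCT^2}<1$ and $\sqrt{2\log(2nrCT^3(T+1))}\ge C$. Suppose $\mathbf{E}\in[0,C]^n$ is unknown to player 1, and the reward vectors $\mathbf{W}[1],\dots,\mathbf{W}[T]\in\mathbb{R}^n$ are i.i.d. with $W_k[t]=E_k+\eta_k[t]$, where each $\eta_k[t]$ is zero-mean and 1-sub-Gaussian (components within a time slot may be dependent). Set $\delta=\frac{1}{2nrCT^2}$, $L=\log\frac{T(T+1)}{\delta}=\log(2nrCT^3(T+1))$, $D=C+2\sqrt{2L}$, $\beta=\frac{1}{D\sqrt{T}}$. Player 1 runs the following UCB procedure: $\mathbf{p}[1]=(r/n,\dots,r/n)$; for $t=1,\dots,T$: with $n_k[t]=\sum_{\tau<t}\alpha_k[\tau]$, $\bar E_k[t]=\frac{1}{\max(1,n_k[t])}\sum_{\tau<t}\alpha_k[\tau]W_k[\tau]$, $\tilde E_k[t]=\bar E_k[t]+\sqrt{\frac{2L}{\max(1,n_k[t])}}$ and $f_t(\mathbf{p},\mathbf{x})=\sum_{k}\frac{\tilde E_k[t]p_k}{1+x_k}$, choose $\mathbf{x}[t]\in\arg\min_{\mathbf{x}\in\mathcal{J}_{m-1}}f_t(\mathbf{p}[t],\mathbf{x})$; draw a random action $\alpha[t]\in\mathcal{J}_1$ with $\mathbb{P}(\alpha_k[t]=1\mid\mathcal{H}[t])=p_k[t]$ for all $k$, and observe $W_k[t]$ for exactly those $k$ with $\alpha_k[t]=1$;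 set $\mathbf{p}[t+1]=\Pi_{\mathcal{I}}\big(\mathbf{p}[t]+\beta\nabla_{\mathbf{p}}f_t(\mathbf{p}[t],\mathbf{x}[t])\big)$ with $(\nabla_{\mathbf{p}}f_t(\mathbf{p},\mathbf{x}))_k=\tilde E_k[t]/(1+x_k)$. Then the worst-case regret satisfies $$R(T):=\sum_{t=1}^T\Big(f^{\mathrm{maximin}}-\mathbb{E}\{f^{\mathrm{worst}}(\mathbf{p}[t])\}\Big)\le nD\sqrt{T}+4n\sqrt{2rT\log(2nrCT^3(T+1))}+1.$$
   Context: $\mathcal{J}_q=\{\mathbf{x}\in\{0,\dots,q\}^n:\sum_jx_j=qr\}$; $\mathcal{I}=\{\mathbf{p}\in[0,1]^n:\sum_kp_k=r\}$; $\Pi_{\mathcal{I}}$ is Euclidean projection onto $\mathcal{I}$; $f(\mathbf{p},\mathbf{x})=\sum_k\frac{E_kp_k}{1+x_k}$; $f^{\mathrm{worst}}(\mathbf{p})=\min_{\mathbf{x}\in\mathcal{J}_{m-1}}f(\mathbf{p},\mathbf{x})$; $f^{\mathrm{maximin}}=\max_{\mathbf{p}\in\mathcal{I}}f^{\mathrm{worst}}(\mathbf{p})$. $\mathcal{H}[t]$ is the history of player 1 before slot $t$: its past actions $\alpha[\tau]$ and observed rewards $\{W_k[\tau]:\alpha_k[\tau]=1\}$, $\tau<t$; the action $\alpha[t]$ is drawn using only $\mathcal{H}[t]$ and independent randomness, and $\mathbf{W}[t]$ is independent of $\mathcal{H}[t]$ and $\alpha[t]$. The expectation is over rewards and player 1's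 randomization; $\log$ is the natural logarithm. *)

(* Defs.v *)
From HB Require Import structures.
From mathcomp Require Import all_boot all_order all_algebra.
From mathcomp Require Import all_classical all_reals all_analysis.
Unset Printing Implicit Defensive.
Import Order.TTheory GRing.Theory Num.Theory.
Local Open Scope classical_set_scope.
Local Open Scope ring_scope.

Section defs.
Context {R : realType}.

Definition Jset (n q r : nat) : set ('I_n -> nat) :=
  [set x | (forall j, (x j <= q)%N) /\ (\sum_(j < n) x j)%N = (q * r)%N].

Definition Iset (n r : nat) : set ('I_n -> R) :=
  [set p | (forall k, 0 <= p k <= 1) /\ \sum_(k < n) p k = r%:R].

Definition fpay {n : nat} (E p : 'I_n -> R) (x : 'I_n -> nat) : R :=
  \sum_(k < n) E k * p k / (1 + (x k)%:R).

(** f^worst(p) = min_{x in J_{m-1}} f(p,x)  (a finite nonempty set: inf = min) *)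
Definition fworst {n : nat} (m r : nat) (E p : 'I_n -> R) : R :=
  inf [set fpay E p x | x in Jset n m.-1 r].

(** f^maximin = max_{p in I} f^worst(p)  (attained: sup = max) *)
Definition fmaximin {n : nat} (m r : nat) (E : 'I_n -> R) : R :=
  sup [set fworst m r E p | p in Iset n r].

Definition is_proj {n : nat} (r : nat) (y z : 'I_n -> R) : Prop :=
  Iset n r z /\
  forall w, Iset n r w -> \sum_(k < n) (y k - z k) ^+ 2 <= \sum_(k < n) (y k - w k) ^+ 2.

Definition ncount {T : Type} {n : nat} (alpha : nat -> T -> 'I_n -> bool)
  (t : nat) (w : T) (k : 'I_n) : nat :=
  (\sum_(1 <= tau < t) (alpha tau w k : nat))%N.

Definition Ebar {T : Type} {n : nat} (alpha : nat -> T -> 'I_n -> bool)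
  (W : nat -> 'I_n -> T -> R) (t : nat) (w : T) (k : 'I_n) : R :=
  (\sum_(1 <= tau < t) (alpha tau w k)%:R * W tau k w)
    / (maxn 1 (ncount alpha t w k))%:R.

Definition Etil {T : Type} {n : nat} (L : R) (alpha : nat -> T -> 'I_n -> bool)
  (W : nat -> 'I_n -> T -> R) (t : nat) (w : T) (k : 'I_n) : R :=
  Ebar alpha W t w k + Num.sqrt (2 * L / (maxn 1 (ncount alpha t w k))%:R).

Definition ft {T : Type} {n : nat} (L : R) (alpha : nat -> T -> 'I_n -> bool)
  (W : nat -> 'I_n -> T -> R) (t : nat) (w : T) (p : 'I_n -> R) (x : 'I_n -> nat) : R :=
  \sum_(k < n) Etil L alpha W t w k * p k / (1 + (x k)%:R).

End defs.

Section prob_defs.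
Context {d : measure_display} {Om : measurableType d} {R : realType}.

Definition sigma_of {I : Type} (S : set I) (X : I -> Om -> R) : set (set Om) :=
  <<s \bigcup_(i in S) preimage_set_system setT (X i) measurable >>.

(** history sigma-algebra: generated by alpha_k[tau] and the observed
    rewards alpha_k[tau] W_k[tau], for tau < a (actions) / tau < b (rewards) *)
Definition hist_sigma {n : nat} (alpha : nat -> Om -> 'I_n -> bool)
  (W : nat -> 'I_n -> Om -> R) (a b : nat) : set (set Om) :=
  <<s (\bigcup_(i in [set i : nat * 'I_n | (1 <= i.1 < a)%N])
         preimage_set_system setT (fun w => ((alpha i.1 w i.2)%:R : R)) measurable)
      `|` (\bigcup_(i in [set i : nat * 'I_n | (1 <= i.1 < b)%N])
         preimage_set_system setT
           (fun w => ((alpha i.1 w i.2)%:R : R) * W i.1 i.2 w) measurable) >>.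

Definition indep2 (P : probability Om R) (F G : set (set Om)) : Prop :=
  forall A B, F A -> G B -> P (A `&` B) = (P A * P B)%E.

Definition mutual_indep (P : probability Om R) (S : set nat)
  (F : nat -> set (set Om)) : Prop :=
  forall (s : seq nat) (A : nat -> set Om), uniq s -> (forall i, i \in s -> S i) ->
    (forall i, i \in s -> F i (A i)) ->
    P (\big[setI/setT]_(i <- s) A i) = (\prod_(i <- s) P (A i))%E.

(** the random vectors X and Y (with components indexed by 'I_n) have the same
    joint law (equality on measurable rectangles, a generating pi-system) *)
Definition same_law {n : nat} (P : probability Om R) (X Y : 'I_n -> Om -> R) : Prop :=
  forall B : 'I_n -> set R, (forall k, measurable (B k)) ->
    P (\big[setI/setT]_(k < n) (X k @^-1` B k)) =
    P (\big[setI/setT]_(k < n) (Y k @^-1` B k)).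

Definition subgauss1 (P : probability Om R) (X : Om -> R) : Prop :=
  ('E_P[X] = 0)%E /\
  forall lam : R, ('E_P[fun w => expR (lam * X w)] <= (expR (lam ^+ 2 / 2))%:E)%E.

End prob_defs.

(* Main.v *)
Require Import Defs.
From HB Require Import structures.
From mathcomp Require Import all_boot all_order all_algebra.
From mathcomp Require Import all_classical all_reals all_analysis.
From mathcomp Require Import measurable_realfun ring lra.
Import Order.TTheory GRing.Theory Num.Theory.
Local Open Scope classical_set_scope.
Local Open Scope ring_scope.

Set Implicit Arguments.
Unset Strict Implicit.

(** Where all empirical means are within [bonus] of the true ones, optimism
    ([E <= Etil <= E + 2 bonus]) and the projected-gradient regret inequality
    give the pathwise bound
    [n D sqrt T + 2 sum_(t, k) bonus_k[t] p_k[t]].  Elsewhere some process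
    [exp (sum_(tau < t) alpha (lam (W - E) - lam^2 / 2))] with
    [lam = +- sqrt (2 L / s)], [1 <= s <= T], is at least [exp L], while the
    regret is at most [T r C].  Hence pathwise, with no case distinction,
    the regret is at most the former bound plus [T r C exp (- L)] times the sum
    of these processes, which are supermartingales of mean at most 1.
    Integrating, [p] may be replaced by [alpha] in front of [bonus], as [bonus]
    is determined by the history, and [sum_t bonus alpha <= 2 sqrt (2 L T)]
    pathwise; the last term contributes
    [T r C * 2 n T^2 * exp (- L) = 1 / (T + 1)]. *)

(** * Projected gradient and worst-case payoff *)

Lemma Iset_segment (R : realType) (n r : nat) (z w : 'I_n -> R) (e : R) :
  Iset n r z -> Iset n r w -> 0 <= e <= 1 ->
  Iset n r (fun k => z k + e * (w k - z k)).
Proof.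
move=> [z01 zr] [w01 wr] /andP[e0 e1]; split=> [k|].
  have /andP[z0 z1] := z01 k; have /andP[w0 w1] := w01 k.
  by apply/andP; split; nra.
by rewrite big_split/= -mulr_sumr sumrB zr wr subrr mulr0 addr0.
Qed.

(** Moving from [z] a fraction [e] of the way to [w] changes the squared distance to [y] by
    [e^2 b - 2 e a], with [a] the sum in the statement and [b] the squared distance from [z] to [w].
    Were [a] positive, a small [e] would beat the minimiser [z]. *)
Lemma is_proj_variational (R : realType) (n r : nat) (y z w : 'I_n -> R) :
  is_proj r y z -> Iset n r w ->
  \sum_(k < n) (y k - z k) * (w k - z k) <= 0.
Proof.
move=> [Iz zmin] Iw; set a := (X in X <= 0); rewrite leNgt; apply/negP => a0.
set b := \sum_(k < n) (w k - z k) ^+ 2.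
have b0 : 0 <= b by apply: sumr_ge0 => k _; exact: sqr_ge0.
have quad (e : R) : 0 <= e <= 1 -> 2 * e * a <= e ^+ 2 * b.
  move=> e01; have := zmin _ (Iset_segment Iz Iw e01).
  have -> : \sum_(k < n) (y k - (z k + e * (w k - z k))) ^+ 2 =
      \sum_(k < n) (y k - z k) ^+ 2 - 2 * e * a + e ^+ 2 * b.
    rewrite /a /b !mulr_sumr -sumrB -big_split/=.
    by apply: eq_bigr => k _; ring.
  by lra.
have ab0 : 0 < a + b by lra.
(* This [e] lies in [[0, 1]] and satisfies [e b = (1 - e) a], which contradicts [2 a <= e b]. *)
have := quad (a / (a + b)).
rewrite ltW ?divr_gt0//= ler_pdivrMr// mul1r lerDl b0 => /(_ isT).
set e := a / (a + b) => h.
have e0 : 0 < e by rewrite divr_gt0.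
have ea : e * (a + b) = a by rewrite /e divfK// gt_eqF.
have : 2 * a <= e * b.
  by rewrite -(ler_pM2l e0); move: h; rewrite expr2; lra.
by nra.
Qed.

(** When the square is expanded around [z], the variational inequality gives the cross term the
    right sign. *)
Lemma is_proj_le_dist (R : realType) (n r : nat) (y z w : 'I_n -> R) :
  is_proj r y z -> Iset n r w ->
  \sum_(k < n) (z k - w k) ^+ 2 <= \sum_(k < n) (y k - w k) ^+ 2.
Proof.
move=> yz Iw; have := is_proj_variational yz Iw.
have -> : \sum_(k < n) (y k - w k) ^+ 2 =
    \sum_(k < n) (z k - w k) ^+ 2 + \sum_(k < n) (y k - z k) ^+ 2
    - 2 * \sum_(k < n) (y k - z k) * (w k - z k).
  rewrite mulr_sumr -big_split -sumrB/=.
  by apply: eq_bigr => k _; ring.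
have : 0 <= \sum_(k < n) (y k - z k) ^+ 2.
  by apply: sumr_ge0 => k _; exact: sqr_ge0.
by lra.
Qed.

(** The two variational inequalities, each tested at the other projection, are added to the
    expansion of a nonnegative square. *)
Lemma is_proj_nonexpansive (R : realType) (n r : nat) (y z y' z' : 'I_n -> R) :
  is_proj r y z -> is_proj r y' z' ->
  \sum_(k < n) (z k - z' k) ^+ 2 <= \sum_(k < n) (y k - y' k) ^+ 2.
Proof.
move=> yz yz'.
have := is_proj_variational yz yz'.1; have := is_proj_variational yz' yz.1.
have : 0 <= \sum_(k < n) ((y k - y' k) - (z k - z' k)) ^+ 2.
  by apply: sumr_ge0 => k _; exact: sqr_ge0.
have -> : \sum_(k < n) ((y k - y' k) - (z k - z' k)) ^+ 2 =
    \sum_(k < n) (y k - y' k) ^+ 2 - \sum_(k < n) (z k - z' k) ^+ 2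
    + 2 * (\sum_(k < n) (y' k - z' k) * (z k - z' k)
           + \sum_(k < n) (y k - z k) * (z' k - z k)).
  rewrite -big_split mulr_sumr -sumrB -big_split/=.
  by apply: eq_bigr => k _; ring.
by lra.
Qed.

Lemma sum_sqr_le_sqr_sum (R : realDomainType) (n : nat) (a : 'I_n -> R) :
  \sum_(k < n) a k ^+ 2 <= (\sum_(k < n) `|a k|) ^+ 2.
Proof.
elim: n a => [|n IH] a; first by rewrite !big_ord0 expr0n.
rewrite !big_ord_recr/=; have := IH (fun i => a (widen_ord (leqnSn n) i)).
have := real_normK (num_real (a ord_max)); have := normr_ge0 (a ord_max).
set A := \sum_(i < n) `|_|.
have : 0 <= A by apply: sumr_ge0.
by nra.
Qed.

(** Nonexpansiveness in the form required by [measurable_fun_lipschitz]: one output coordinate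
    against the l1 distance of the inputs. *)
Lemma is_proj_lipschitz (R : realType) (n r : nat) (y z y' z' : 'I_n -> R) k :
  is_proj r y z -> is_proj r y' z' ->
  `|z k - z' k| <= \sum_(j < n) `|y j - y' j|.
Proof.
move=> yz yz'; rewrite -ler_sqr ?nnegrE ?sumr_ge0// real_normK ?num_real//.
apply: le_trans (sum_sqr_le_sqr_sum _).
apply: le_trans (is_proj_nonexpansive yz yz').
rewrite [leRHS](bigD1 k)//= lerDl.
by apply: sumr_ge0 => j _; exact: sqr_ge0.
Qed.

(** Projection does not increase the distance to [q], so [|p[t+1] - q|^2 <= |p[t] - q|^2 - 2 beta
    g[t].(q - p[t]) + beta^2 |g[t]|^2]; these inequalities telescope. *)
Lemma projected_gradient_regret (R : realType) (n r T : nat) (beta : R)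
    (p g : nat -> 'I_n -> R) (q : 'I_n -> R) : 0 < beta ->
  (forall t, (1 <= t <= T)%N ->
     is_proj r (fun k => p t k + beta * g t k) (p t.+1)) ->
  Iset n r q ->
  \sum_(1 <= t < T.+1) \sum_(k < n) g t k * (q k - p t k) <=
    (\sum_(k < n) (p 1%N k - q k) ^+ 2) / (2 * beta)
    + beta / 2 * \sum_(1 <= t < T.+1) \sum_(k < n) g t k ^+ 2.
Proof.
move=> b0 projp Iq.
(* The final distance is kept on the left for the induction on [T] and dropped afterwards. *)
suff H : 2 * beta * \sum_(1 <= t < T.+1) \sum_(k < n) g t k * (q k - p t k)
    + \sum_(k < n) (p T.+1 k - q k) ^+ 2 <= \sum_(k < n) (p 1%N k - q k) ^+ 2
    + beta ^+ 2 * \sum_(1 <= t < T.+1) \sum_(k < n) g t k ^+ 2.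
  have bb0 : 0 < 2 * beta by lra.
  rewrite -(ler_pM2l bb0) mulrDr mulrCA divff ?gt_eqF// mulr1.
  have : 0 <= \sum_(k < n) (p T.+1 k - q k) ^+ 2.
    by apply: sumr_ge0 => k _; exact: sqr_ge0.
  by move: H; set G := \sum_(1 <= t < T.+1) \sum_(k < n) g t k ^+ 2; nra.
elim: T projp => [_|T IH projp]; first by rewrite !big_nil !mulr0 add0r addr0.
have /IH{}IH : forall t, (1 <= t <= T)%N ->
    is_proj r (fun k => p t k + beta * g t k) (p t.+1).
  by move=> t /andP[t1 tT]; apply: projp; rewrite t1 leqW.
rewrite !(big_nat_recr T.+1)//= !mulrDr.
have := is_proj_le_dist (projp T.+1 (leqnn _)) Iq.
have -> : \sum_(k < n) (p T.+1 k + beta * g T.+1 k - q k) ^+ 2 =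
    \sum_(k < n) (p T.+1 k - q k) ^+ 2
    + beta ^+ 2 * \sum_(k < n) g T.+1 k ^+ 2
    - 2 * beta * \sum_(k < n) g T.+1 k * (q k - p T.+1 k).
  rewrite !mulr_sumr -big_split -sumrB/=.
  by apply: eq_bigr => k _; ring.
by lra.
Qed.

(** * Sums of inverse square roots of counts *)

Lemma inv_sqrt_le (R : realType) (N : nat) :
  (Num.sqrt N.+1%:R)^-1 <= 2 * (Num.sqrt N.+1%:R - Num.sqrt N%:R) :> R.
Proof.
set a := Num.sqrt N.+1%:R; set b := Num.sqrt N%:R.
have a0 : 0 < a by rewrite sqrtr_gt0 ltr0n.
have a2 : a ^+ 2 = N%:R + 1 by rewrite sqr_sqrtr// -natr1.
have b2 : b ^+ 2 = N%:R by rewrite sqr_sqrtr.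
(* Since [a^2 = b^2 + 1], one has [2 a (a - b) = (a - b)^2 + 1]. *)
rewrite -(ler_pM2l a0) divff ?gt_eqF//.
by have := sqr_ge0 (a - b); nra.
Qed.

(** Each slot with [a t] raises the count by one, so the sum is at most the total increment of a
    potential [psi] of the count. *)
Lemma sum_count_inv_sqrt (R : realType) (a : nat -> bool) (T : nat) :
  \sum_(1 <= t < T.+1) (a t)%:R /
     Num.sqrt (maxn 1 (\sum_(1 <= tau < t) a tau)%N)%:R
  <= 2 * Num.sqrt T%:R :> R.
Proof.
pose N t := (\sum_(1 <= tau < t) a tau)%N.
(* Counts 0 and 1 both cost 1 because of the [maxn], whence [psi 1 = 1] and [psi 2 = 2]. From then
   on [psi k = 2 sqrt (k - 1)], lagging by one because the count excludes the current slot. *)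
pose psi (k : nat) : R :=
  if k is k'.+1 then Num.max 1 (2 * Num.sqrt k'%:R) else 0.
have psiS k : (Num.sqrt (maxn 1 k)%:R)^-1 <= psi k.+1 - psi k.
  case: k => [|[|k]].
  - by rewrite /psi maxn0 sqrtr1 invr1 sqrtr0 mulr0 subr0 le_max lexx.
  - rewrite /psi maxnn sqrtr1 invr1 sqrtr0 mulr0 (max_l ler01) lerBrDr le_max.
    by apply/orP; right; lra.
  - rewrite (maxn_idPr _)// /psi.
    have h j : 1 <= 2 * Num.sqrt j.+1%:R :> R.
      have : 1 <= Num.sqrt j.+1%:R :> R.
        by rewrite -[leLHS]sqrtr1 ler_sqrt ?ler1n// ltr0n.
      by lra.
    by rewrite !max_r ?h//; have := inv_sqrt_le R k.+1; lra.
have psi_le k : psi k <= 2 * Num.sqrt k%:R.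
  case: k => [|k]; first by rewrite /psi sqrtr0 mulr0.
  have : 1 <= Num.sqrt k.+1%:R :> R.
    by rewrite -[leLHS]sqrtr1 ler_sqrt ?ler1n// ltr0n.
  have : Num.sqrt k%:R <= Num.sqrt k.+1%:R :> R.
    by rewrite ler_sqrt ?ltr0n// ler_nat.
  by rewrite /psi ge_max => h1 h2; apply/andP; split; lra.
have NT t : (N t.+1 <= t)%N.
  rewrite /N; elim: t => [|t IH]; first by rewrite big_nil.
  by rewrite big_nat_recr//= -[in X in (_ <= X)%N]addn1 leq_add// leq_b1.
suff : \sum_(1 <= t < T.+1) (a t)%:R / Num.sqrt (maxn 1 (N t))%:R
    <= psi (N T.+1).
  move=> /le_trans; apply; apply: le_trans (psi_le _) _.
  by rewrite ler_pM2l ?ltr0n// ler_wsqrtr// ler_nat; exact: NT.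
elim: T => [|T IH]; first by rewrite /N !big_nil.
have NS : N T.+2 = (N T.+1 + a T.+1)%N by rewrite /N big_nat_recr.
rewrite big_nat_recr//= NS.
case: (a T.+1); last by rewrite addn0 mul0r addr0.
by rewrite mul1r addn1; have := psiS (N T.+1); lra.
Qed.

(** * Bounds and stability of the worst-case payoff *)

Lemma fpay_le_fpayD (R : realType) (n : nat) (E E' p p' c : 'I_n -> R)
    (y : 'I_n -> nat) :
  (forall k, 0 <= c k) -> (forall k, E k * p k <= E' k * p' k + c k) ->
  fpay E p y <= fpay E' p' y + \sum_(k < n) c k.
Proof.
move=> c0 le; rewrite /fpay -big_split/=; apply: ler_sum => k _.
have y1 : 1 <= 1 + (y k)%:R :> R by rewrite lerDl.
have y0 := lt_le_trans ltr01 y1.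
rewrite ler_pdivrMr// mulrDl divfK ?gt_eqF//.
by apply: le_trans (le k) _; rewrite lerD2l ler_peMr.
Qed.

Lemma fpay_ge0 (R : realType) (n : nat) (E p : 'I_n -> R) (y : 'I_n -> nat) :
  (forall k, 0 <= E k) -> (forall k, 0 <= p k) -> 0 <= fpay E p y.
Proof.
by move=> E0 p0; apply: sumr_ge0 => k _; rewrite !mulr_ge0// invr_ge0 addr_ge0.
Qed.

Lemma fworst_le_fpay (R : realType) (n m r : nat) (E p : 'I_n -> R)
    (y : 'I_n -> nat) :
  (forall k, 0 <= E k) -> (forall k, 0 <= p k) -> Jset n m.-1 r y ->
  fworst m r E p <= fpay E p y.
Proof.
move=> E0 p0 Jy; apply: ge_inf; last by exists y.
by exists 0 => _ [z _ <-]; exact: fpay_ge0.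
Qed.

Lemma le_fworst (R : realType) (n m r : nat) (E p : 'I_n -> R) (c : R) :
  Jset n m.-1 r !=set0 ->
  (forall y, Jset n m.-1 r y -> c <= fpay E p y) -> c <= fworst m r E p.
Proof.
move=> [y Jy] cle; apply: lb_le_inf; first by exists (fpay E p y), y.
by move=> _ [z Jz <-]; exact: cle.
Qed.

Lemma fworst_ge0 (R : realType) (n m r : nat) (E p : 'I_n -> R) :
  Jset n m.-1 r !=set0 -> (forall k, 0 <= E k) -> (forall k, 0 <= p k) ->
  0 <= fworst m r E p.
Proof. by move=> J0 E0 p0; apply: le_fworst => // y _; exact: fpay_ge0. Qed.

(** A minimum of functions sharing one Lipschitz bound obeys that bound. The constant [C] sits
    inside the norms to match [measurable_fun_lipschitz]. *)
Lemma fworst_lipschitz (R : realType) (n m r : nat) (C : R) (E p q : 'I_n -> R) :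
  Jset n m.-1 r !=set0 -> (forall k, 0 <= E k <= C) ->
  (forall k, 0 <= p k) -> (forall k, 0 <= q k) ->
  `|fworst m r E p - fworst m r E q| <= \sum_(k < n) `|C * p k - C * q k|.
Proof.
move=> J0 E0C.
have E0 k : 0 <= E k by have /andP[] := E0C k.
suff H (p' q' : 'I_n -> R) : (forall k, 0 <= p' k) -> (forall k, 0 <= q' k) ->
    fworst m r E p' - fworst m r E q' <= \sum_(k < n) `|C * p' k - C * q' k|.
  move=> p0 q0; rewrite ler_norml H// andbT.
  have := H _ _ q0 p0; under eq_bigr do rewrite distrC.
  by lra.
move=> p0 q0; rewrite lerBlDr -lerBlDl; apply: le_fworst => // y Jy.
rewrite lerBlDl addrC; apply: le_trans (fworst_le_fpay E0 p0 Jy) _.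
apply: fpay_le_fpayD => // k; rewrite -lerBlDl -!mulrBr normrM.
apply: le_trans (ler_norm _) _; rewrite normrM ler_wpM2r// ger0_norm//.
by apply: le_trans (ler_norm C); have /andP[] := E0C k.
Qed.

Lemma fworst_le (R : realType) (n m r : nat) (C : R) (E p : 'I_n -> R) :
  Jset n m.-1 r !=set0 -> (forall k, 0 <= E k <= C) -> Iset n r p ->
  fworst m r E p <= r%:R * C.
Proof.
move=> [y Jy] E0C [p01 pr].
have E0 k : 0 <= E k by have /andP[] := E0C k.
have p0 k : 0 <= p k by have /andP[] := p01 k.
apply: le_trans (fworst_le_fpay E0 p0 Jy) _.
(* Comparison with the zero payoff, with error [C * p k] in coordinate [k]. *)
have := @fpay_le_fpayD R n E (fun=> 0) p (fun=> 0) (fun k => C * p k) y.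
have -> : fpay (fun=> 0) (fun=> 0) y = 0 :> R.
  by rewrite /fpay big1// => k _; rewrite !mul0r.
rewrite add0r -mulr_sumr pr (mulrC C); apply=> k.
  by rewrite mulr_ge0//; have /andP[] := E0C k; exact: le_trans.
by rewrite mul0r add0r ler_wpM2r//; have /andP[] := E0C k.
Qed.

Lemma fworst_le_fmaximin (R : realType) (n m r : nat) (C : R) (E p : 'I_n -> R) :
  Jset n m.-1 r !=set0 -> (forall k, 0 <= E k <= C) -> Iset n r p ->
  fworst m r E p <= fmaximin m r E.
Proof.
move=> J0 E0C Ip; apply: ub_le_sup; last by exists p.
by exists (r%:R * C) => _ [q Iq <-]; exact: fworst_le.
Qed.

Lemma fmaximin_le (R : realType) (n m r : nat) (E : 'I_n -> R) (c : R) :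
  Iset (R := R) n r !=set0 ->
  (forall q, Iset n r q -> fworst m r E q <= c) -> fmaximin m r E <= c.
Proof.
move=> [q Iq] le; apply: ge_sup; first by exists (fworst m r E q), q.
by move=> _ [q' Iq' <-]; exact: le.
Qed.

Lemma Iset_uniform (R : realType) (n r : nat) : (0 < r < n)%N ->
  Iset (R := R) n r (fun=> r%:R / n%:R).
Proof.
move=> /andP[r0 rn]; have n0 : 0 < n%:R :> R by rewrite ltr0n (ltn_trans r0).
split=> [k|]; first by rewrite divr_ge0//= ler_pdivrMr// mul1r ler_nat ltnW.
by rewrite sumr_const card_ord -[LHS]mulr_natr divfK// gt_eqF.
Qed.

Lemma Iset_dist_le (R : realType) (n r : nat) (p q : 'I_n -> R) :
  Iset n r p -> Iset n r q -> \sum_(k < n) (p k - q k) ^+ 2 <= n%:R.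
Proof.
move=> [p01 _] [q01 _]; rewrite -[X in _ <= X%:R]card_ord -sumr_const.
by apply: ler_sum => k _; have := p01 k; have := q01 k; nra.
Qed.

(* Optimism: [E <= Et] bounds the comparator's value by [f_t(q, x_t)], while
   [Et <= E + 2 B] bounds the loss in replacing [f] by [f_t] at [p_t]. *)
Lemma optimistic_gap (R : realType) (n m r : nat) (E Et B p q : 'I_n -> R)
    (x : 'I_n -> nat) :
  (forall k, 0 <= E k) -> (forall k, 0 <= B k) ->
  (forall k, E k <= Et k <= E k + 2 * B k) ->
  Iset n r p -> Iset n r q -> Jset n m.-1 r x ->
  (forall y, Jset n m.-1 r y -> fpay Et p x <= fpay Et p y) ->
  fworst m r E q - fworst m r E p <=
    \sum_(k < n) Et k / (1 + (x k)%:R) * (q k - p k)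
    + 2 * \sum_(k < n) B k * p k.
Proof.
move=> E0 B0 EEt [p01 _] [q01 _] Jx xmin.
have p0 k : 0 <= p k by have /andP[] := p01 k.
have q0 k : 0 <= q k by have /andP[] := q01 k.
have qle : fworst m r E q <= fpay Et q x.
  apply: le_trans (fworst_le_fpay E0 q0 Jx) _.
  have := @fpay_le_fpayD R n E Et q q (fun=> 0) x.
  rewrite big1// addr0; apply=> // k.
  by rewrite addr0 ler_wpM2r//; have /andP[] := EEt k.
have ple : fpay Et p x - 2 * \sum_(k < n) B k * p k <= fworst m r E p.
  apply: le_fworst; first by exists x.
  move=> y Jy; rewrite lerBlDr; apply: le_trans (xmin _ Jy) _.
  rewrite mulr_sumr; apply: fpay_le_fpayD => k.
    by rewrite !mulr_ge0.
  by rewrite mulrA -mulrDl ler_wpM2r//; have /andP[] := EEt k.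
have -> : \sum_(k < n) Et k / (1 + (x k)%:R) * (q k - p k) =
    fpay Et q x - fpay Et p x.
  by rewrite /fpay -sumrB; apply: eq_bigr => k _;
    rewrite mulrBr !(mulrAC _ _^-1).
by lra.
Qed.

(** [optimistic_gap] is summed over the slots and its linear part bounded by the projected gradient
    regret; gradient entries lie in [[0, D]] and the squared diameter of [Iset] is at most [n]. *)
Lemma optimistic_regret (R : realType) (n m r T : nat) (D : R)
    (E : 'I_n -> R) (Et B p : nat -> 'I_n -> R) (x : nat -> 'I_n -> nat) :
  (0 < T)%N -> 0 < D ->
  (forall k, 0 <= E k) -> (forall t k, 0 <= B t k) ->
  (forall t k, (1 <= t <= T)%N ->
     E k <= Et t k <= E k + 2 * B t k /\ Et t k <= D) ->
  (forall t, (1 <= t <= T)%N -> Iset n r (p t)) ->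
  (forall t, (1 <= t <= T)%N -> Jset n m.-1 r (x t) /\
     forall y, Jset n m.-1 r y -> fpay (Et t) (p t) (x t) <= fpay (Et t) (p t) y) ->
  (forall t, (1 <= t <= T)%N ->
     is_proj r (fun k => p t k
       + 1 / (D * Num.sqrt T%:R) * (Et t k / (1 + (x t k)%:R))) (p t.+1)) ->
  \sum_(1 <= t < T.+1) (fmaximin m r E - fworst m r E (p t)) <=
    n%:R * D * Num.sqrt T%:R
    + 2 * \sum_(1 <= t < T.+1) \sum_(k < n) B t k * p t k.
Proof.
move=> T0 D0 E0 B0 EEt Ip xmin projp.
set M := (X in _ <= X).
have T1 : (1 <= 1 <= T)%N by rewrite T0.
have TR0 : 0 < T%:R :> R by rewrite ltr0n.
(* A fixed comparator suffices: after division by [T], a bound valid for every [q] passes to the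
   supremum. *)
suff H q : Iset n r q ->
    \sum_(1 <= t < T.+1) (fworst m r E q - fworst m r E (p t)) <= M.
  rewrite sumrB big_const_nat subn1/= iter_addr_0 lerBlDr -mulr_natr.
  rewrite -ler_pdivlMr//; apply: fmaximin_le; first by exists (p 1%N); exact: Ip.
  move=> q /H; rewrite ler_pdivlMr// mulr_natr sumrB big_const_nat.
  by rewrite subn1/= iter_addr_0 /M; lra.
move=> Iq; set beta := 1 / (D * Num.sqrt T%:R).
have S0 : 0 < Num.sqrt T%:R :> R by rewrite sqrtr_gt0.
have S2 : Num.sqrt T%:R ^+ 2 = T%:R :> R by rewrite sqr_sqrtr// ltW.
have b0 : 0 < beta by rewrite divr_gt0// mulr_gt0.
pose g t k := Et t k / (1 + (x t k)%:R).
have := @projected_gradient_regret R n r T beta p g q b0 projp Iq.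
have g2 : \sum_(1 <= t < T.+1) \sum_(k < n) g t k ^+ 2 <= T%:R * (n%:R * D ^+ 2).
  have -> : T%:R * (n%:R * D ^+ 2) = \sum_(1 <= t < T.+1) \sum_(k < n) D ^+ 2.
    rewrite sumr_const card_ord big_const_nat subn1/= iter_addr_0.
    by rewrite -!(mulr_natl (_ ^+ _)) -(mulr_natl (_ * _)).
  rewrite big_nat_cond [leRHS]big_nat_cond; apply: ler_sum => t.
  rewrite andbT ltnS => tT; apply: ler_sum => k _.
  have [/andP[Ele _] leD] := EEt t k tT.
  have Et0 : 0 <= Et t k := le_trans (E0 k) Ele.
  have y0 : 0 < 1 + (x t k)%:R :> R by rewrite ltr_wpDr.
  rewrite /g ler_sqr ?nnegrE ?(ltW D0)//; last by rewrite divr_ge0// ltW.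
  by rewrite ler_pdivrMr// (le_trans leD)// ler_peMr ?lerDl// ltW.
have d2 : \sum_(k < n) (p 1%N k - q k) ^+ 2 <= n%:R := Iset_dist_le (Ip _ T1) Iq.
have step : \sum_(1 <= t < T.+1) (fworst m r E q - fworst m r E (p t)) <=
    \sum_(1 <= t < T.+1) \sum_(k < n) g t k * (q k - p t k)
    + 2 * \sum_(1 <= t < T.+1) \sum_(k < n) B t k * p t k.
  rewrite mulr_sumr -big_split/=.
  rewrite big_nat_cond [leRHS]big_nat_cond; apply: ler_sum => t.
  rewrite andbT ltnS => tT; have [Jx xm] := xmin _ tT.
  by apply: optimistic_gap => // [k|]; [have [] := EEt t k tT | exact: Ip].
move=> ogd; apply: le_trans step _; rewrite lerD2r.
apply: le_trans ogd _.
(* With this [beta] the two terms are equal, each being [n D sqrt T / 2]. *)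
have -> : n%:R * D * Num.sqrt T%:R =
    n%:R / (2 * beta) + beta / 2 * (T%:R * (n%:R * D ^+ 2)).
  rewrite -[X in _ / 2 * (X * _)]S2 /beta; field.
  by rewrite !gt_eqF.
apply: lerD; first by rewrite ler_wpM2r// invr_ge0; lra.
by rewrite ler_wpM2l//; lra.
Qed.

(** * Measurability and independence *)

(* [h] factors through a Lipschitz function of [y], so each [h > c] is the
   union of the preimages of the rational l1-balls on which [h > c]. *)
Lemma measurable_fun_lipschitz (R : realType) (d : measure_display)
    (Om : measurableType d) (n : nat) (y : 'I_n -> Om -> R) (h : Om -> R) :
  (forall k, measurable_fun setT (y k)) ->
  (forall w w', `|h w - h w'| <= \sum_(k < n) `|y k w - y k w'|) ->
  measurable_fun setT h.
Proof.
move=> my hlip mT; apply: (measurability _ (RGenOInfty.measurableE R)) => //.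
move=> /= _ [_ [c ->] <-]; rewrite preimage_itvoy setTI.
pose dist (q : {ffun 'I_n -> rat}) w := \sum_(k < n) `|y k w - ratr (q k)|.
have mdist q : measurable_fun setT (dist q).
  apply: measurable_sum => k; apply: measurableT_comp => //.
  by apply: measurable_funB.
pose ball (i : {ffun 'I_n -> rat} * rat) := [set w | dist i.1 w < ratr i.2].
pose F i := if pselect (ball i `<=` [set w | c < h w]) then ball i else set0.
rewrite [X in measurable X](_ : _ = \bigcup_i F i); last first.
  apply/seteqP; split => [w /= chw|w [i _]]; last first.
    by rewrite /F; case: pselect => //= sub; exact: sub.
  have n1 : 0 < n%:R + 1 :> R by rewrite ltr_wpDl.
  (* Half the gap: [h] differs by less than [2 e] between [w] and any other point of a ball of
     radius below [e] containing [w]. *)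
  pose e := (h w - c) / 2.
  have e0 : 0 < e by rewrite /e; lra.
  have [b] := rat_in_itvoo e0; rewrite in_itv/= => /andP[b0 be].
  have en : 0 < ratr b / (n%:R + 1) :> R by rewrite divr_gt0.
  have /choice[q Hq] : forall k, exists a : rat,
      `|y k w - ratr a| < ratr b / (n%:R + 1) :> R.
    move=> k; have : y k w - ratr b / (n%:R + 1) < y k w by lra.
    move=> /rat_in_itvoo[a]; rewrite in_itv/= => /andP[ya1 ya2]; exists a.
    by rewrite ger0_norm; lra.
  pose i := ([ffun k => q k], b); exists i => //.
  have wi : ball i w.
    rewrite /ball/= /dist; apply: (@le_lt_trans _ _ (n%:R * (ratr b / (n%:R + 1)))).
      rewrite -[X in X%:R * _]card_ord mulr_natl -sumr_const.
      by apply: ler_sum => k _; rewrite ffunE ltW.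
    by rewrite mulrA ltr_pdivrMr// mulrC ltr_pM2l// ltrDl.
  rewrite /F; case: pselect => // -[] w' /= w'i.
  have : `|h w - h w'| <= dist i.1 w + dist i.1 w'.
    rewrite -big_split/=; apply: le_trans (hlip _ _) _; apply: ler_sum => k _.
    by rewrite (distrC (y k w') (ratr _)); exact: ler_distD.
  move=> hh; have := le_lt_trans (le_trans (ler_norm _) hh) (ltrD wi w'i).
  by move: be; rewrite /e/=; lra.
apply: countable_bigcupT_measurable; first exact: countableP.
move=> i; rewrite /F; case: pselect => //= _.
rewrite /ball -[X in measurable X]setTI.
have := mdist i.1 measurableT _ (measurable_itv `]-oo, (ratr i.2 : R)[).
by rewrite preimage_itvNyo.
Qed.

Lemma ge0_integral_sum_EFin (R : realType) (d : measure_display)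
    (Om : measurableType d) (P : {measure set Om -> \bar R}) (I : Type)
    (s : seq I) (f : I -> Om -> R) :
  (forall i, measurable_fun setT (f i)) -> (forall i w, 0 <= f i w) ->
  (\int[P]_w (\sum_(i <- s) f i w)%:E = \sum_(i <- s) \int[P]_w (f i w)%:E)%E.
Proof.
move=> mf f0; rewrite -ge0_integral_sum//.
- by apply: eq_integral => w _; rewrite sumEFin.
- by move=> i; exact/measurable_EFinP.
- by move=> i w _; rewrite lee_fin.
Qed.

(** Independence on rectangles identifies the law of [(X, Y)] with the product of the laws, and
    Tonelli's theorem then splits the integral. *)
Lemma indep_integral_mul (R : realType) (d : measure_display)
    (Om : measurableType d) (P : probability Om R) (X Y : Om -> R) :
  measurable_fun setT X -> measurable_fun setT Y ->
  (forall w, 0 <= X w) -> (forall w, 0 <= Y w) ->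
  (forall A B, measurable A -> measurable B ->
     P (X @^-1` A `&` Y @^-1` B) = (P (X @^-1` A) * P (Y @^-1` B))%E) ->
  (\int[P]_w (X w * Y w)%:E = (\int[P]_w (X w)%:E) * \int[P]_w (Y w)%:E)%E.
Proof.
move=> mX mY X0 Y0 ind.
pose X' : {mfun Om >-> R} := HB.pack X (isMeasurableFun.Build _ _ _ _ X mX).
pose Y' : {mfun Om >-> R} := HB.pack Y (isMeasurableFun.Build _ _ _ _ Y mY).
pose XY w := (X w, Y w).
have mXY : measurable_fun setT XY by exact: measurable_fun_pair.
pose Z' : {mfun Om >-> (R * R)%type} := HB.pack XY (isMeasurableFun.Build _ _ _ _ XY mXY).
(* The absolute values make the integrand nonnegative on the whole plane, not only on the range of
   [(X, Y)]. *)
pose f (z : R * R) : \bar R := (`|z.1| * `|z.2|)%:E.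
have mf : measurable_fun setT f.
  by apply/measurable_EFinP; apply: measurable_funM; apply: measurableT_comp.
have f0 z : (0 <= f z)%E by rewrite lee_fin mulr_ge0.
have mnE : measurable_fun [set: R] (fun x : R => `|x|%:E).
  by apply/measurable_EFinP; exact: normr_measurable.
transitivity (\int[distribution P Z']_z f z)%E.
  rewrite ge0_integral_distribution//; apply: eq_integral => w _ /=.
  by rewrite /f /= !ger0_norm.
transitivity (\int[distribution P X' \x distribution P Y']_z f z)%E.
  apply: eq_measure_integral => A mA _; apply/esym.
  by apply: product_measure_unique => // B C mB mC; exact: ind.
rewrite fubini_tonelli1//= /fubini_F.
transitivity (\int[distribution P X']_x
    (`|x|%:E * \int[distribution P Y']_y `|y|%:E))%E.
  by apply: eq_integral => x _; rewrite -ge0_integralZl.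
rewrite ge0_integralZr//; last by apply: integral_ge0 => y _; rewrite lee_fin.
by congr (_ * _)%E; rewrite ge0_integral_distribution//;
  apply: eq_integral => w _ /=; rewrite ger0_norm.
Qed.

(** Measurability is assumed only inside the range of summation, so the summands are replaced by 0
    outside it. *)
Lemma measurable_sum_nat (R : realType) (d : measure_display)
    (Om : measurableType d) (a b : nat) (h : nat -> Om -> R) :
  (forall i, (a <= i < b)%N -> measurable_fun setT (h i)) ->
  measurable_fun setT (fun w => \sum_(a <= i < b) h i w).
Proof.
move=> mh.
pose h' i w := if (a <= i < b)%N then h i w else 0.
rewrite (_ : (fun w => _) = (fun w => \sum_(a <= i < b) h' i w)).
  apply: measurable_sum => i; rewrite /h'; case: (boolP (a <= i < b)%N) => [/mh//|_].
  exact: measurable_cst.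
by apply/funext => w; apply: eq_big_nat => i iab; rewrite /h' iab.
Qed.

Lemma ge0_integral_sum_nat (R : realType) (d : measure_display)
    (Om : measurableType d) (P : {measure set Om -> \bar R}) (a b : nat)
    (f : nat -> Om -> R) :
  (forall i, (a <= i < b)%N -> measurable_fun setT (f i)) ->
  (forall i w, (a <= i < b)%N -> 0 <= f i w) ->
  (\int[P]_w (\sum_(a <= i < b) f i w)%:E =
   \sum_(a <= i < b) \int[P]_w (f i w)%:E)%E.
Proof.
move=> mf f0; pose f' i w := if (a <= i < b)%N then f i w else 0.
transitivity (\int[P]_w (\sum_(a <= i < b) f' i w)%:E)%E.
  apply: eq_integral => w _; congr EFin.
  by apply: eq_big_nat => i iab; rewrite /f' iab.
rewrite ge0_integral_sum_EFin.
- apply: eq_big_nat => i iab; apply: eq_integral => w _.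
  by rewrite /f' iab.
- by move=> i; rewrite /f'; case: (boolP (a <= i < b)%N) => [/mf//|_]; exact: measurable_cst.
- by move=> i w; rewrite /f'; case: ifPn => [/f0|].
Qed.

Lemma measurable_fun_of_nat (R : realType) (d : measure_display)
    (Om : measurableType d) (N : Om -> nat) (g : nat -> R) :
  (forall v, measurable (N @^-1` [set v])) ->
  measurable_fun setT (fun w => g (N w)).
Proof.
move=> mN _ Y mY; rewrite setTI.
rewrite [X in measurable X](_ : _ =
    \bigcup_(v in [set v | Y (g v)]) N @^-1` [set v]).
  by apply: bigcup_measurable => v _; exact: mN.
by apply/seteqP; split => [w /= Yw|w [v /= Yv /= ->]//]; exists (N w).
Qed.

(** The sigma-algebra on [Om] is arbitrary so that the lemma also covers the history, where it puts
    the level sets of the count among the events one may condition on. *)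
Lemma measurable_ncount_eq (R : realType) (d : measure_display)
    (Om : measurableType d) (n : nat) (alpha : nat -> Om -> 'I_n -> bool)
    (t : nat) (k : 'I_n) (v : nat) :
  (forall tau, (1 <= tau < t)%N ->
     measurable_fun setT (fun w => (alpha tau w k)%:R : R)) ->
  measurable ((fun w => ncount alpha t w k) @^-1` [set v]).
Proof.
move=> ma; have := @measurable_sum_nat R _ _ 1 t _ ma.
move=> /(_ measurableT [set v%:R] (measurable_set1 _)); rewrite setTI.
congr measurable; apply/seteqP; rewrite /ncount; split => w /=.
  by rewrite -natr_sum => /eqP; rewrite eqr_nat => /eqP.
by rewrite -natr_sum => ->.
Qed.

Lemma ncount_lt (Om : Type) (n : nat) (alpha : nat -> Om -> 'I_n -> bool)
    (t : nat) (w : Om) (k : 'I_n) : (1 <= t)%N -> (ncount alpha t w k < t)%N.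
Proof.
case: t => // t _; rewrite ltnS /ncount; elim: t => [|t IH].
  by rewrite big_nil.
by rewrite big_nat_recr//= -[in X in (_ <= X)%N]addn1 leq_add// leq_b1.
Qed.

(** * Concentration of the empirical means *)

Definition bonus {R : realType} {Om : Type} {n : nat} (L : R)
    (alpha : nat -> Om -> 'I_n -> bool) (t : nat) (w : Om) (k : 'I_n) : R :=
  Num.sqrt (2 * L / (maxn 1 (ncount alpha t w k))%:R).

(** The exponential supermartingale of the noise of coordinate [k]; the compensator [lam^2 / 2] is
    charged only in slots where [k] is played. *)
Definition expmart {R : realType} {Om : Type} {n : nat}
    (alpha : nat -> Om -> 'I_n -> bool) (W : nat -> 'I_n -> Om -> R)
    (E : 'I_n -> R) (k : 'I_n) (lam : R) (t : nat) (w : Om) : R :=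
  expR (\sum_(1 <= tau < t)
    (alpha tau w k)%:R * (lam * (W tau k w - E k) - lam ^+ 2 / 2)).

(** Only the observed products [alpha * W] are assumed measurable, so the lemma applies to the
    history sigma-algebra, which need not see unobserved rewards. *)
Lemma measurable_expmart (R : realType) (d : measure_display)
    (Om : measurableType d) (n : nat) (alpha : nat -> Om -> 'I_n -> bool)
    (W : nat -> 'I_n -> Om -> R) (E : 'I_n -> R) (k : 'I_n) (lam : R) (t : nat) :
  (forall tau, (1 <= tau < t)%N ->
     measurable_fun setT (fun w => (alpha tau w k)%:R : R)) ->
  (forall tau, (1 <= tau < t)%N ->
     measurable_fun setT (fun w => (alpha tau w k)%:R * W tau k w)) ->
  measurable_fun setT (expmart alpha W E k lam t).
Proof.
move=> ma maW; apply: measurableT_comp => //.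
apply: measurable_sum_nat => tau taut.
rewrite (_ : (fun w => _) = (fun w => lam * ((alpha tau w k)%:R * W tau k w)
    - (lam * E k + lam ^+ 2 / 2) * (alpha tau w k)%:R)).
  apply: measurable_funB; apply: measurable_funM => //; [exact: maW|exact: ma].
by apply/funext => w; ring.
Qed.

(** The generators of [hist_sigma], named so that [g_sigma_algebraType] turns the history into a
    measurable space. *)
Definition hist_gen {R : realType} {d : measure_display} {Om : measurableType d}
    {n : nat} (alpha : nat -> Om -> 'I_n -> bool) (W : nat -> 'I_n -> Om -> R)
    (a b : nat) : set (set Om) :=
  (\bigcup_(i in [set i : nat * 'I_n | (1 <= i.1 < a)%N])
     preimage_set_system setT (fun w => ((alpha i.1 w i.2)%:R : R)) measurable)
  `|` (\bigcup_(i in [set i : nat * 'I_n | (1 <= i.1 < b)%N])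
     preimage_set_system setT
       (fun w => ((alpha i.1 w i.2)%:R : R) * W i.1 i.2 w) measurable).

Lemma hist_measurable_action (R : realType) (d : measure_display)
    (Om : measurableType d) (n : nat) (alpha : nat -> Om -> 'I_n -> bool)
    (W : nat -> 'I_n -> Om -> R) (a b tau : nat) (k : 'I_n) :
  (1 <= tau < a)%N ->
  measurable_fun (setT : set (g_sigma_algebraType (hist_gen alpha W a b)))
    (fun w => (alpha tau w k)%:R : R).
Proof.
move=> tau_a _ B mB; apply: sub_sigma_algebra; left; exists (tau, k) => //.
by exists B.
Qed.

Lemma hist_measurable_reward (R : realType) (d : measure_display)
    (Om : measurableType d) (n : nat) (alpha : nat -> Om -> 'I_n -> bool)
    (W : nat -> 'I_n -> Om -> R) (a b tau : nat) (k : 'I_n) :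
  (1 <= tau < b)%N ->
  measurable_fun (setT : set (g_sigma_algebraType (hist_gen alpha W a b)))
    (fun w => (alpha tau w k)%:R * W tau k w : R).
Proof.
move=> tau_b _ B mB; apply: sub_sigma_algebra; right; exists (tau, k) => //.
by exists B.
Qed.

Lemma hist_sigma_measurable (R : realType) (d : measure_display)
    (Om : measurableType d) (n : nat) (alpha : nat -> Om -> 'I_n -> bool)
    (W : nat -> 'I_n -> Om -> R) (a b : nat) :
  (forall tau k, (1 <= tau < a)%N ->
     measurable_fun setT (fun w => (alpha tau w k)%:R : R)) ->
  (forall tau k, (1 <= tau < b)%N ->
     measurable_fun setT (fun w => (alpha tau w k)%:R * W tau k w)) ->
  hist_sigma alpha W a b `<=` measurable.
Proof.
move=> ma maW; apply: smallest_sub; first exact: sigma_algebra_measurable.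
move=> A [[[tau k]/= lt_tau [B mB <-]]|[[tau k]/= lt_tau [B mB <-]]].
  exact: ma.
exact: maW.
Qed.

(** Split on whether [k] is played: the reward of slot [t] occurs only in the last factor, ready to
    be separated by independence. *)
Lemma expmart_recr (R : realType) (Om : Type) (n : nat)
    (alpha : nat -> Om -> 'I_n -> bool) (W : nat -> 'I_n -> Om -> R)
    (E : 'I_n -> R) (k : 'I_n) (lam : R) (t : nat) (w : Om) : (1 <= t)%N ->
  expmart alpha W E k lam t.+1 w =
    expmart alpha W E k lam t w * (1 - (alpha t w k)%:R)
    + expmart alpha W E k lam t w * (alpha t w k)%:R * expR (- (lam ^+ 2 / 2))
      * expR (lam * (W t k w - E k)).
Proof.
move=> t1; rewrite /expmart big_nat_recr//= expRD.
case: (alpha t w k); last by rewrite mul0r expR0 subr0 !mulr0 !mul0r addr0.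
rewrite mul1r subrr mulr0 add0r mulr1 -[in RHS]mulrA -[in RHS]expRD.
by congr (_ * expR _); ring.
Qed.

(* [expmart] is a supermartingale: conditionally on the history and the action,
   the reward noise of slot [t] multiplies it by a factor of mean at most 1. *)
Lemma integral_expmart_le1 (R : realType) (d : measure_display)
    (Om : measurableType d) (P : probability Om R) (n T : nat)
    (alpha : nat -> Om -> 'I_n -> bool) (W : nat -> 'I_n -> Om -> R)
    (E : 'I_n -> R) (k : 'I_n) (lam : R) (t : nat) :
  (forall t, (1 <= t <= T)%N ->
     measurable_fun setT (fun w => (alpha t w k)%:R : R)) ->
  (forall t, (1 <= t <= T)%N -> measurable_fun setT (W t k)) ->
  (forall t, (1 <= t <= T)%N -> subgauss1 P (fun w => W t k w - E k)) ->
  (forall t, (1 <= t <= T)%N ->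
     indep2 P (sigma_of setT (W t)) (hist_sigma alpha W t.+1 t)) ->
  (t <= T)%N -> (\int[P]_w (expmart alpha W E k lam t.+1 w)%:E <= 1)%E.
Proof.
move=> ma mW subg ind.
have maW t' : (1 <= t' <= T)%N ->
    measurable_fun setT (fun w => (alpha t' w k)%:R * W t' k w).
  by move=> t'T; apply: measurable_funM; [exact: ma|exact: mW].
have mZ t' : (t' <= T)%N -> measurable_fun setT (expmart alpha W E k lam t'.+1).
  move=> t'T; apply: measurable_expmart => tau /andP[tau1 tau_t].
    by apply: ma; rewrite tau1 (leq_trans _ t'T).
  by apply: maW; rewrite tau1 (leq_trans _ t'T).
have Z0 t' w : 0 <= expmart alpha W E k lam t' w by exact: expR_ge0.
elim: t => [_|t IH tT].
  under eq_integral do rewrite /expmart big_nil expR0.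
  by rewrite integral_cst//= probability_setT mule1.
apply: le_trans (IH (ltnW tT)).
have tT' : (1 <= t.+1 <= T)%N by [].
set Z := expmart alpha W E k lam t.+1.
set a := fun w => (alpha t.+1 w k)%:R : R.
have a0 w : 0 <= a w by rewrite /a.
have a1 w : 0 <= 1 - a w by rewrite /a; case: (alpha _ _ _); rewrite ?subrr ?subr0.
set c := expR (- (lam ^+ 2 / 2)).
have c0 : 0 <= c := expR_ge0 _.
pose V w := expR (lam * (W t.+1 k w - E k)).
pose U w := Z w * a w * c.
have mV : measurable_fun setT V.
  apply: measurableT_comp => //; apply: measurable_funM => //.
  by apply: measurable_funB => //; exact: mW.
have mZt : measurable_fun setT Z by apply: mZ; exact: ltnW.
have mat : measurable_fun setT a by exact: ma.
have mZa : measurable_fun setT (fun w => Z w * a w) by exact: measurable_funM.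
have mU : measurable_fun setT U by exact: measurable_funM.
have V0 w : 0 <= V w := expR_ge0 _.
have Zt0 w : 0 <= Z w := Z0 _ _.
have U0 w : 0 <= U w by rewrite /U mulr_ge0// mulr_ge0.
have mZ1a : measurable_fun setT (fun w => Z w * (1 - a w)).
  by apply: measurable_funM => //; apply: measurable_funB.
have Ufactor : (\int[P]_w (U w * V w)%:E =
    (\int[P]_w (U w)%:E) * \int[P]_w (V w)%:E)%E.
  apply: indep_integral_mul => // A B mA mB.
  rewrite setIC muleC; apply: (ind _ tT').
  - pose G := \bigcup_(i in [set: 'I_n])
      preimage_set_system setT (W t.+1 i) (measurable : set (set R)).
    have mWG : measurable_fun (setT : set (g_sigma_algebraType G)) (W t.+1 k).
      by move=> _ D mD; apply: sub_sigma_algebra; exists k => //; exists D.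
    have mVG : measurable_fun (setT : set (g_sigma_algebraType G)) V.
      apply: measurableT_comp => //; apply: measurable_funM => //.
      by apply: measurable_funB.
    by have := mVG measurableT B mB; rewrite setTI.
  (* Bounds are strict: actions up to slot [t.+1] are included, since [U] contains [a], but rewards
     only up to slot [t]. *)
  - pose G := hist_gen alpha W t.+2 t.+1.
    have mZG : measurable_fun (setT : set (g_sigma_algebraType G)) Z.
      apply: measurable_expmart => tau /andP[tau1 tau_t].
        by apply: hist_measurable_action; rewrite tau1 ltnW.
      by apply: hist_measurable_reward; rewrite tau1.
    have mUG : measurable_fun (setT : set (g_sigma_algebraType G)) U.
      apply: measurable_funM => //; apply: measurable_funM => //.
      by apply: hist_measurable_action; rewrite /= ltnSn.
    by have := mUG measurableT A mA; rewrite setTI.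
have -> : (\int[P]_w (expmart alpha W E k lam t.+2 w)%:E =
    \int[P]_w (Z w * (1 - a w))%:E + \int[P]_w (U w * V w)%:E)%E.
  rewrite -ge0_integralD//.
  - by apply: eq_integral => w _; rewrite -EFinD expmart_recr.
  - by move=> w _; rewrite lee_fin mulr_ge0.
  - exact/measurable_EFinP.
  - by move=> w _; rewrite lee_fin mulr_ge0.
  - by apply/measurable_EFinP; apply: measurable_funM.
(* Splitting [Z] in the same way leaves only the played parts to compare. *)
have -> : (\int[P]_w (Z w)%:E =
    \int[P]_w (Z w * (1 - a w))%:E + \int[P]_w (Z w * a w)%:E)%E.
  rewrite -ge0_integralD//.
  - by apply: eq_integral => w _; rewrite -EFinD; congr EFin; ring.
  - by move=> w _; rewrite lee_fin mulr_ge0.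
  - exact/measurable_EFinP.
  - by move=> w _; rewrite lee_fin mulr_ge0.
  - exact/measurable_EFinP.
apply: leeD => //; rewrite Ufactor.
have [_ /(_ lam)] := subg _ tT'; rewrite unlock => subV.
(* The sub-Gaussian bound on the mean of [V] is exactly cancelled by the factor [c] in [U]. *)
apply: (@le_trans _ _ ((\int[P]_w (U w)%:E) * (expR (lam ^+ 2 / 2))%:E)%E).
  by apply: lee_wpmul2l => //; apply: integral_ge0 => w _; rewrite lee_fin.
rewrite muleC -ge0_integralZl//.
- rewrite le_eqVlt; apply/orP; left; apply/eqP; apply: eq_integral => w _.
  rewrite -EFinM; congr EFin; rewrite /U /c mulrCA -expRD subrr.
  by rewrite expR0 mulr1.
- exact/measurable_EFinP.
- by move=> w _; rewrite lee_fin.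
Qed.

(* [p] is the conditional probability of [S] on each level set of [N], hence
   weights depending only on [N] do not see the difference. *)
Lemma integral_mul_cond_prob (R : realType) (d : measure_display)
    (Om : measurableType d) (P : probability Om R) (N : Om -> nat) (t : nat)
    (c : nat -> R) (S : set Om) (p : Om -> R) :
  (forall w, (N w < t)%N) -> (forall v, measurable (N @^-1` [set v])) ->
  measurable S -> measurable_fun setT p -> (forall w, 0 <= p w) ->
  (forall v, 0 <= c v) ->
  (forall v, P (N @^-1` [set v] `&` S) =
     (\int[P]_(w in N @^-1` [set v]) (p w)%:E)%E) ->
  (\int[P]_w (c (N w) * p w)%:E = \int[P]_w (c (N w) * \1_S w)%:E)%E.
Proof.
move=> Nt mN mS mp p0 c0 condp.
pose A v := N @^-1` [set v].
(* As [N < t], finitely many level sets cover the space. *)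
have split (f : Om -> R) w :
    c (N w) * f w = \sum_(v < t) c v * (f w * \1_(A v) w).
  rewrite (bigD1 (Ordinal (Nt w)))//= big1 => [|v].
    by rewrite addr0 indicE mem_set//= mulr1.
  rewrite -val_eqE/= => vN; rewrite indicE memNset ?mulr0// /A/= => Nv.
  by rewrite Nv eqxx in vN.
have main (f : Om -> R) : measurable_fun setT f -> (forall w, 0 <= f w) ->
    (\int[P]_w (c (N w) * f w)%:E =
     \sum_(v < t) (c v)%:E * \int[P]_w (f w * \1_(A v) w)%:E)%E.
  move=> mf f0.
  have mfA v : measurable_fun setT (fun w => f w * \1_(A v) w).
    by apply: measurable_funM => //; apply: measurable_indic; exact: mN.
  under eq_integral do rewrite split.
  rewrite ge0_integral_sum_EFin.
  - apply: eq_bigr => v _; rewrite -ge0_integralZl_EFin//.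
    + by move=> w _; rewrite lee_fin mulr_ge0.
    + exact/measurable_EFinP.
  - by move=> v; apply: measurable_funM.
  - by move=> v w; rewrite !mulr_ge0.
rewrite (main p)// (main (\1_S : Om -> R)); last 2 first.
- exact: measurable_indic.
- by move=> w; rewrite indicE.
apply: eq_bigr => v _; congr (_ * _)%E.
transitivity (\int[P]_(w in A v) (p w)%:E)%E.
  rewrite [RHS]integral_mkcond; apply: eq_integral => w _.
  by rewrite EFinM epatch_indic.
rewrite -condp; transitivity (\int[P]_w (\1_(A v `&` S) w)%:E)%E.
  by rewrite integral_indic ?setIT//; apply: measurableI => //; exact: mN.
by apply: eq_integral => w _; rewrite setIC indicI.
Qed.

Lemma expmartE (R : realType) (Om : Type) (n : nat)
    (alpha : nat -> Om -> 'I_n -> bool) (W : nat -> 'I_n -> Om -> R)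
    (E : 'I_n -> R) (k : 'I_n) (lam : R) (t : nat) (w : Om) :
  let N := (ncount alpha t w k)%:R in
  expmart alpha W E k lam t w =
    expR (lam * (\sum_(1 <= tau < t) (alpha tau w k)%:R * W tau k w - N * E k)
          - lam ^+ 2 / 2 * N).
Proof.
rewrite /= /expmart /ncount natr_sum mulr_suml -sumrB !mulr_sumr -sumrB.
by congr expR; apply: eq_bigr => tau _; ring.
Qed.

(* Exponent [lam N |Ebar - E| - lam^2 N / 2] at its optimum [lam = sqrt (2 L / N)]. *)
Lemma deviation_expmart (R : realType) (Om : Type) (n : nat) (L : R)
    (alpha : nat -> Om -> 'I_n -> bool) (W : nat -> 'I_n -> Om -> R)
    (E : 'I_n -> R) (k : 'I_n) (t : nat) (w : Om) :
  0 < L -> (0 < ncount alpha t w k)%N ->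
  bonus L alpha t w k < `|Ebar alpha W t w k - E k| ->
  exists b : bool, expR L <= expmart alpha W E k
    ((-1) ^+ b * Num.sqrt (2 * L / (ncount alpha t w k)%:R)) t w.
Proof.
move=> L0 N0; rewrite /bonus /Ebar (maxn_idPr _)//.
set N := (ncount alpha t w k)%:R; set l := Num.sqrt _.
set S := \sum_(1 <= tau < t) _ => dev.
have NR : 0 < N :> R by rewrite ltr0n.
have l0 : 0 <= l by exact: sqrtr_ge0.
have l2N : l ^+ 2 * N = 2 * L.
  by rewrite sqr_sqrtr ?divfK ?gt_eqF// divr_ge0 ?ltW//; lra.
have SN : S - N * E k = N * (S / N - E k).
  by rewrite mulrBr mulrCA divff ?gt_eqF// mulr1.
(* Since [l^2 N = 2 L], the right-hand side at [y = l] is [2 L - L]. *)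
have key y : l < y -> L <= l * (N * y) - l ^+ 2 / 2 * N.
  move=> ly; have : l * N * l <= l * N * y.
    by rewrite ler_wpM2l ?(ltW ly)// mulr_ge0// ltW.
  by move: l2N; rewrite expr2; lra.
have [pos|neg] := leP 0 (S / N - E k).
  exists false; rewrite expmartE -/N -/S expr0 mul1r ler_expR SN; apply: key.
  by rewrite -[ltRHS]ger0_norm.
(* A negative deviation is caught by the process with the opposite sign of [lam]. *)
exists true; rewrite expmartE -/N -/S expr1 mulN1r sqrrN ler_expR SN.
rewrite mulNr -mulrN -(mulrN N); apply: key.
by rewrite -[ltRHS]ltr0_norm.
Qed.

(** * Pathwise regret bound *)

Lemma ucb_regret_pointwise (R : realType) (Om : Type) (n m r T : nat) (C L : R)
    (E : 'I_n -> R) (W : nat -> 'I_n -> Om -> R)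
    (alpha : nat -> Om -> 'I_n -> bool) (p : nat -> Om -> 'I_n -> R)
    (x : nat -> Om -> 'I_n -> nat) (w : Om) :
  let D := C + 2 * Num.sqrt (2 * L) in
  (0 < T)%N -> 0 < C -> 0 < L -> C <= Num.sqrt (2 * L) ->
  (forall k, 0 <= E k <= C) ->
  (forall t, (1 <= t <= T)%N -> Iset n r (p t w)) ->
  (forall t, (1 <= t <= T)%N -> Jset n m.-1 r (x t w) /\
     forall y, Jset n m.-1 r y ->
       ft L alpha W t w (p t w) (x t w) <= ft L alpha W t w (p t w) y) ->
  (forall t, (1 <= t <= T)%N ->
     is_proj r (fun k => p t w k + 1 / (D * Num.sqrt T%:R)
         * (Etil L alpha W t w k / (1 + (x t w k)%:R))) (p t.+1 w)) ->
  \sum_(1 <= t < T.+1) (fmaximin m r E - fworst m r E (p t w)) <=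
    n%:R * D * Num.sqrt T%:R
    + 2 * (\sum_(1 <= t < T.+1) \sum_(k < n) bonus L alpha t w k * p t w k)
    + T%:R * (r%:R * C) / expR L * (\sum_(1 <= t < T.+1) \sum_(k < n)
        \sum_(s < T) \sum_(b : bool)
          expmart alpha W E k ((-1) ^+ b * Num.sqrt (2 * L / s.+1%:R)) t w).
Proof.
move=> D T0 C0 L0 CL E0C Ip xmin projp.
have E0 k : 0 <= E k by have /andP[] := E0C k.
have p0 t k : (1 <= t <= T)%N -> 0 <= p t w k.
  by move=> /Ip[/(_ k)/andP[]].
have S0 := sqrtr_ge0 (2 * L).
have D0 : 0 < D by rewrite /D; lra.
have B0 t k : 0 <= bonus L alpha t w k by exact: sqrtr_ge0.
have J0 : Jset n m.-1 r !=set0.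
  by exists (x 1%N w); have [] := xmin 1%N; rewrite ?T0.
set Z := (X in _ / expR L * X).
have Zpos t : 0 <= \sum_(k < n) \sum_(s < T) \sum_(b : bool)
    expmart alpha W E k ((-1) ^+ b * Num.sqrt (2 * L / s.+1%:R)) t w.
  by do 3![apply: sumr_ge0 => ? _]; exact: expR_ge0.
have Z0 : 0 <= Z by apply: sumr_ge0 => t _.
have K0 : 0 <= T%:R * (r%:R * C) / expR L.
  by rewrite divr_ge0 ?expR_ge0// !mulr_ge0// ltW.
have [good|] := pselect (forall t k, (1 <= t <= T)%N ->
    `|Ebar alpha W t w k - E k| <= bonus L alpha t w k).
  apply: ler_wpDr; first exact: mulr_ge0.
  apply: (@optimistic_regret R n m r T D E (fun t => Etil L alpha W t w)
    (fun t => bonus L alpha t w) (fun t => p t w) (fun t => x t w)) => //.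
  move=> t k tT; have := good t k tT; rewrite ler_norml => /andP[lo hi].
  (* Hence [Etil <= E + 2 bonus <= C + 2 sqrt (2 L) = D], the bound on the gradient entries. *)
  have BS : bonus L alpha t w k <= Num.sqrt (2 * L).
    rewrite ler_wsqrtr// ler_pdivrMr ?ltr0n ?leq_max//.
    by rewrite ler_peMr ?ler1n ?leq_max// mulr_ge0 ?ltW.
  have -> : Etil L alpha W t w k = Ebar alpha W t w k + bonus L alpha t w k by [].
  have /andP[_ EC] := E0C k.
  by split; [apply/andP; split|]; rewrite ?/D; lra.
move=> /existsNP[t /existsNP[k /not_implyP[tT /negP]]]; rewrite -ltNge => dev.
have t1 : (1 <= t)%N by have /andP[] := tT.
(* Without samples, [Ebar = 0] and the bonus is [sqrt (2 L) >= C >= E k], so no deviation is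
   possible. *)
have N0 : (0 < ncount alpha t w k)%N.
  rewrite lt0n; apply/eqP => N0; move: dev; rewrite ltNge => /negP; apply.
  have -> : Ebar alpha W t w k = 0.
    rewrite /Ebar big_nat big1 ?mul0r// => tau ttau.
    move: N0; rewrite /ncount => /eqP; rewrite sum_nat_seq_eq0 => /allP/(_ tau).
    rewrite mem_index_iota ttau => /(_ isT)/=.
    by case: (alpha tau w k) => //; rewrite mul0r.
  rewrite sub0r normrN /bonus N0 maxn0 divr1 ger0_norm//.
  by apply: le_trans CL; have /andP[] := E0C k.
have [b Lb] := deviation_expmart L0 N0 dev.
(* The count lies between 1 and [T]; the sum over [s < T] uses [s.+1], hence the predecessor. *)
have ltT : ((ncount alpha t w k).-1 < T)%N.
  rewrite prednK//; have := ncount_lt alpha w k t1; have /andP[_] := tT.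
  by move=> tT' /ltnW/leq_trans; exact.
have LZ : expR L <= Z.
  apply: le_trans Lb _; rewrite /Z (big_rem t)/=; last by rewrite mem_index_iota.
  apply: ler_wpDr; first by apply: sumr_ge0.
  rewrite (bigD1 k)//=; apply: ler_wpDr.
    by do 3![apply: sumr_ge0 => ? _]; exact: expR_ge0.
  rewrite (bigD1 (Ordinal ltT))//=; apply: ler_wpDr.
    by do 2![apply: sumr_ge0 => ? _]; exact: expR_ge0.
  rewrite (bigD1 b)//=; apply: ler_wpDr.
    by apply: sumr_ge0 => ? _; exact: expR_ge0.
  by rewrite prednK.
(* Each slot loses at most [r C], and the factor [Z / expR L] multiplying [T r C] is at least 1
   here. *)
apply: (@le_trans _ _ (T%:R * (r%:R * C))).
  have -> : T%:R * (r%:R * C) = \sum_(1 <= t < T.+1) (r%:R * C).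
    by rewrite big_const_nat subn1/= iter_addr_0 mulr_natl.
  rewrite big_nat_cond [leRHS]big_nat_cond; apply: ler_sum => t' /andP[tT' _].
  rewrite lerBlDr; apply: ler_wpDr.
    by apply: fworst_ge0 => // j; exact: p0.
  apply: fmaximin_le; first by exists (p t w); exact: Ip.
  by move=> q Iq; exact: fworst_le.
apply: ler_wpDl.
  apply: addr_ge0; first by rewrite !mulr_ge0 ?sqrtr_ge0// ltW.
  apply: mulr_ge0 => //; rewrite big_nat; apply: sumr_ge0 => t' tT'.
  by apply: sumr_ge0 => j _; rewrite mulr_ge0// p0.
rewrite mulrAC -mulrA ler_peMr//; first by rewrite !mulr_ge0// ltW.
by rewrite ler_pdivlMr ?expR_gt0// mul1r.
Qed.

(** * Measurability of the estimates and iterates *)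

Lemma measurable_Etil (R : realType) (d : measure_display)
    (Om : measurableType d) (n : nat) (L : R)
    (alpha : nat -> Om -> 'I_n -> bool) (W : nat -> 'I_n -> Om -> R)
    (t : nat) (k : 'I_n) :
  (forall tau, (1 <= tau < t)%N ->
     measurable_fun setT (fun w => (alpha tau w k)%:R : R)) ->
  (forall tau, (1 <= tau < t)%N -> measurable_fun setT (W tau k)) ->
  measurable_fun setT (fun w => Etil L alpha W t w k).
Proof.
move=> ma mW; rewrite /Etil /Ebar.
have mN v := @measurable_ncount_eq R _ _ n alpha t k v ma.
apply: measurable_funD; first apply: measurable_funM.
- apply: measurable_sum_nat => tau taut.
  by apply: measurable_funM; [exact: ma|exact: mW].
- exact: (@measurable_fun_of_nat R _ _ _ (fun v => (maxn 1 v)%:R^-1) mN).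
- exact: (@measurable_fun_of_nat R _ _ _
    (fun v => Num.sqrt (2 * L / (maxn 1 v)%:R)) mN).
Qed.

(** By induction the gradient step is measurable, and the projection is a Lipschitz function of it;
    no formula for the projection is required. *)
Lemma measurable_ucb_iterate (R : realType) (d : measure_display)
    (Om : measurableType d) (n r T : nat) (L beta : R) (p1 : 'I_n -> R)
    (W : nat -> 'I_n -> Om -> R) (alpha : nat -> Om -> 'I_n -> bool)
    (p : nat -> Om -> 'I_n -> R) (x : nat -> Om -> 'I_n -> nat) (t : nat) :
  (forall t k, (1 <= t <= T)%N ->
     measurable_fun setT (fun w => (alpha t w k)%:R : R)) ->
  (forall t k, (1 <= t <= T)%N -> measurable_fun setT (W t k)) ->
  (forall t k v, (1 <= t <= T)%N ->
     measurable ((fun w => x t w k) @^-1` [set v])) ->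
  (forall w, p 1%N w = p1) ->
  (forall t w, (1 <= t <= T)%N ->
     is_proj r (fun k => p t w k + beta
         * (Etil L alpha W t w k / (1 + (x t w k)%:R))) (p t.+1 w)) ->
  (t <= T)%N -> forall k, measurable_fun setT (fun w => p t.+1 w k).
Proof.
move=> ma mW mx hp1 projp; elim: t => [_ k|t IH tT k].
  rewrite (_ : (fun w => _) = cst (p1 k)); first exact: measurable_cst.
  by apply/funext => w; rewrite hp1.
have tT' : (1 <= t.+1 <= T)%N by [].
apply: (@measurable_fun_lipschitz R _ _ n (fun j w => p t.+1 w j + beta
    * (Etil L alpha W t.+1 w j / (1 + (x t.+1 w j)%:R)))); last first.
  by move=> w w'; exact: is_proj_lipschitz (projp _ w tT') (projp _ w' tT').
move=> j; apply: measurable_funD; first exact: IH (ltnW tT) j.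
apply: measurable_funM => //; apply: measurable_funM.
  by apply: measurable_Etil => tau /andP[tau1 tau_t];
    [apply: ma|apply: mW]; rewrite tau1 (leq_trans _ tT)// ltnW.
exact: (@measurable_fun_of_nat R _ _ _ (fun v => (1 + v%:R)^-1)
  (fun v => mx _ j v tT')).
Qed.

(** * Expected regret *)

(** Boundedness makes the integral of [X] finite, so it can be cancelled in the extended reals. *)
Lemma integral_bounded_compl (R : realType) (d : measure_display)
    (Om : measurableType d) (P : probability Om R) (c : R) (X : Om -> R) :
  measurable_fun setT X -> (forall w, 0 <= X w <= c) ->
  (c%:E - \int[P]_w (X w)%:E = \int[P]_w (c - X w)%:E)%E.
Proof.
move=> mX X0c.
have X0 w : (0 <= (X w)%:E)%E by rewrite lee_fin; have /andP[] := X0c w.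
have cX0 w : (0 <= (c - X w)%:E)%E.
  by rewrite lee_fin subr_ge0; have /andP[] := X0c w.
have mcX : measurable_fun setT (fun w => (c - X w)%:E).
  by apply/measurable_EFinP; apply: measurable_funB.
have mXE : measurable_fun setT (fun w => (X w)%:E) by exact/measurable_EFinP.
have intc : (\int[P]_w (cst c%:E w) = c%:E)%E.
  by rewrite integral_cst//= probability_setT mule1.
have sumc : (c%:E = \int[P]_w (c - X w)%:E + \int[P]_w (X w)%:E)%E.
  rewrite -ge0_integralD// -[LHS]intc; apply: eq_integral => w _ /=.
  by rewrite -EFinD subrK.
have Xfin : (\int[P]_w (X w)%:E)%E \is a fin_num.
  rewrite ge0_fin_numE; last exact: integral_ge0.
  apply: (@le_lt_trans _ _ c%:E); last exact: ltry.
  rewrite [leRHS]sumc; apply: leeDr; exact: integral_ge0.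
by rewrite {1}sumc addeK.
Qed.

Lemma integral_const_le (R : realType) (d : measure_display)
    (Om : measurableType d) (P : probability Om R) (c : R) (X : Om -> R) :
  measurable_fun setT X -> (forall w, 0 <= X w <= c) ->
  (\int[P]_w (X w)%:E <= c%:E)%E.
Proof.
move=> mX X0c.
have -> : (c%:E = \int[P]_w (cst c%:E w))%E.
  by rewrite integral_cst//= probability_setT mule1.
apply: ge0_le_integral => //.
- by move=> w _; rewrite lee_fin; have /andP[] := X0c w.
- exact/measurable_EFinP.
- by move=> w _; rewrite lee_fin; have /andP[] := X0c w.
Qed.

(** With [sqrt (2 L)] factored out, [sum_count_inv_sqrt] applies to each of the [n] coordinates
    along the path. *)
Lemma sum_bonus_le (R : realType) (Om : Type) (n T : nat) (L : R)
    (alpha : nat -> Om -> 'I_n -> bool) (w : Om) : 0 <= L ->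
  \sum_(1 <= t < T.+1) \sum_(k < n) bonus L alpha t w k * (alpha t w k)%:R
  <= n%:R * (Num.sqrt (2 * L) * (2 * Num.sqrt T%:R)).
Proof.
move=> L0; rewrite exchange_big/= -[X in X%:R * _]card_ord mulr_natl -sumr_const.
apply: ler_sum => k _.
apply: (@le_trans _ _ (Num.sqrt (2 * L) * \sum_(1 <= t < T.+1)
    (alpha t w k)%:R / Num.sqrt (maxn 1 (ncount alpha t w k))%:R)).
  rewrite mulr_sumr; apply: ler_sum => t _.
  rewrite /bonus sqrtrM ?mulr_ge0// sqrtrV ?ler0n//.
  by rewrite -mulrA [_^-1 * _]mulrC.
rewrite ler_wpM2l ?sqrtr_ge0//.
exact: (@sum_count_inv_sqrt R (fun t => alpha t w k) T).
Qed.

Theorem theorem2 (R : realType) (d : measure_display) (Om : measurableType d)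
  (P : probability Om R) (n m r T : nat) (C : R) (E : 'I_n -> R)
  (W : nat -> 'I_n -> Om -> R) (alpha : nat -> Om -> 'I_n -> bool)
  (p : nat -> Om -> 'I_n -> R) (x : nat -> Om -> 'I_n -> nat) :
  (2 <= n)%N -> (2 <= m)%N -> (0 < r < n)%N -> 0 < C -> (0 < T)%N ->
  1 / (2 * n%:R * r%:R * C * T%:R ^+ 2) < 1 ->
  let L := ln (2 * n%:R * r%:R * C * T%:R ^+ 3 * (T%:R + 1)) in
  C <= Num.sqrt (2 * L) ->
  let D := C + 2 * Num.sqrt (2 * L) in
  let beta := 1 / (D * Num.sqrt T%:R) in
  (* unknown mean reward vector E in [0,C]^n *)
  (forall k, 0 <= E k <= C) ->
  (* rewards W[t] = E + eta[t], i.i.d., zero-mean 1-sub-Gaussian noise *)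
  (forall t k, (1 <= t <= T)%N -> measurable_fun setT (W t k)) ->
  (forall t k, (1 <= t <= T)%N -> subgauss1 P (fun w => W t k w - E k)) ->
  mutual_indep P [set t | (1 <= t <= T)%N] (fun t => sigma_of setT (W t)) ->
  (forall t, (1 <= t <= T)%N -> same_law P (W t) (W 1%N)) ->
  (* random actions alpha[t] in J_1 with P(alpha_k[t] = 1 | H[t]) = p_k[t] *)
  (forall t k, (1 <= t <= T)%N -> measurable [set w | alpha t w k]) ->
  (forall t w, (1 <= t <= T)%N -> Jset n 1 r (fun k => nat_of_bool (alpha t w k))) ->
  (forall t k A, (1 <= t <= T)%N -> hist_sigma alpha W t t A ->
     P (A `&` [set w | alpha t w k]) = (\int[P]_(w in A) (p t w k)%:E)%E) ->
  (* W[t] independent of (H[t], alpha[t]) *)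
  (forall t, (1 <= t <= T)%N ->
     indep2 P (sigma_of setT (W t)) (hist_sigma alpha W t.+1 t)) ->
  (* the UCB procedure *)
  (forall w, p 1%N w = (fun _ => r%:R / n%:R)) ->
  (forall t w, (1 <= t <= T)%N ->
     Jset n m.-1 r (x t w) /\
     forall y, Jset n m.-1 r y ->
       ft L alpha W t w (p t w) (x t w) <= ft L alpha W t w (p t w) y) ->
  (forall t k v, (1 <= t <= T)%N ->
     hist_sigma alpha W t t ((fun w => x t w k) @^-1` [set v])) ->
  (forall t w, (1 <= t <= T)%N ->
     is_proj r (fun k => p t w k + beta * (Etil L alpha W t w k / (1 + (x t w k)%:R)))
       (p t.+1 w)) ->
  (\sum_(1 <= t < T.+1)
      ((fmaximin m r E)%:E - 'E_P[fun w => fworst m r E (p t w)])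
   <= (n%:R * D * Num.sqrt T%:R
       + 4 * n%:R * Num.sqrt (2 * r%:R * T%:R * L) + 1)%:E)%E.
Proof.
move=> n2 m2 r0n C0 T0 _ L CL D beta E0C mW subg _ _ mA Jalpha condp ind hp1.
move=> xmin xhist projp.
have n0 : 0 < n%:R :> R by rewrite ltr0n (leq_trans _ n2).
have r0 : 0 < r%:R :> R by rewrite ltr0n; case/andP: r0n.
have TR0 : 0 < T%:R :> R by rewrite ltr0n.
(* Positivity of [L] follows from [0 < C <= sqrt (2 L)]. *)
have L0 : 0 < L.
  have : 0 < Num.sqrt (2 * L) := lt_le_trans C0 CL.
  by rewrite sqrtr_gt0; lra.
have expL : expR L = 2 * n%:R * r%:R * C * T%:R ^+ 3 * (T%:R + 1).
  by rewrite lnK// posrE !mulr_gt0// ?exprn_gt0//; lra.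
have E0 k : 0 <= E k by have /andP[] := E0C k.
have ma t k : (1 <= t <= T)%N ->
    measurable_fun setT (fun w => (alpha t w k)%:R : R).
  move=> tT; rewrite (_ : (fun w => _) = \1_[set w | alpha t w k]).
    by apply: measurable_indic; exact: mA.
  apply/funext => w; rewrite indicE; congr (nat_of_bool _)%:R.
  by apply/idP/idP => [aw|/set_mem//]; apply: mem_set.
have lt_le t tau : (1 <= t <= T)%N -> (1 <= tau < t)%N -> (1 <= tau <= T)%N.
  by move=> /andP[_ tT] /andP[-> /ltnW/leq_trans]; exact.
have maW t k : (1 <= t <= T)%N ->
    measurable_fun setT (fun w => (alpha t w k)%:R * W t k w).
  by move=> tT; apply: measurable_funM; [exact: ma|exact: mW].
have mx t k v : (1 <= t <= T)%N -> measurable ((fun w => x t w k) @^-1` [set v]).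
  move=> tT; apply: (@hist_sigma_measurable R _ _ n alpha W t t);
    last exact: xhist.
  - by move=> tau j /(lt_le _ _ tT); exact: ma.
  - by move=> tau j /(lt_le _ _ tT); exact: maW.
have mp t k : (1 <= t <= T)%N -> measurable_fun setT (fun w => p t w k).
  case: t => // t tT.
  by apply: (measurable_ucb_iterate ma mW mx hp1 projp); exact: ltnW.
have Ip t w : (1 <= t <= T)%N -> Iset n r (p t w).
  case: t => // -[_|t tT]; first by rewrite hp1; exact: Iset_uniform.
  by have [] := projp t.+1 w (ltnW tT).
have p0 t w k : (1 <= t <= T)%N -> 0 <= p t w k.
  by move=> /(Ip _ w)[/(_ k)/andP[]].
have J0 (w : Om) : Jset n m.-1 r !=set0.
  by exists (x 1%N w); have [] := xmin 1%N w; rewrite ?T0.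
pose X t w := fworst m r E (p t w).
have mX t : (1 <= t <= T)%N -> measurable_fun setT (X t).
  move=> tT; apply: (@measurable_fun_lipschitz R _ _ n (fun k w => C * p t w k)).
    by move=> k; apply: measurable_funM => //; exact: mp.
  by move=> w w'; apply: fworst_lipschitz => //= [|k|k]; [exact: J0|exact: p0..].
have X0c t w : (1 <= t <= T)%N -> 0 <= X t w <= fmaximin m r E.
  move=> tT; rewrite fworst_ge0/=; [|exact: J0|done|by move=> k; exact: p0].
  by apply: fworst_le_fmaximin E0C _; [exact: J0|exact: Ip].
pose Bp w := \sum_(1 <= t < T.+1) \sum_(k < n) bonus L alpha t w k * p t w k.
pose Ba w : R :=
  \sum_(1 <= t < T.+1) \sum_(k < n) bonus L alpha t w k * (alpha t w k)%:R.
pose lam (b : bool) (s : nat) : R := (-1) ^+ b * Num.sqrt (2 * L / s.+1%:R).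
pose Z w := \sum_(1 <= t < T.+1) \sum_(k < n) \sum_(s < T) \sum_(b : bool)
  expmart alpha W E k (lam b s) t w.
have mN t k v : (1 <= t <= T)%N ->
    measurable ((fun w => ncount alpha t w k) @^-1` [set v]).
  move=> tT; apply: (@measurable_ncount_eq R) => tau /(lt_le _ _ tT).
  exact: ma.
have mb t k : (1 <= t <= T)%N -> measurable_fun setT (fun w => bonus L alpha t w k).
  move=> tT; exact: (@measurable_fun_of_nat R _ _ _
    (fun v => Num.sqrt (2 * L / (maxn 1 v)%:R)) (fun v => mN t k v tT)).
have b0 t w k : 0 <= bonus L alpha t w k by exact: sqrtr_ge0.
have mbp t k : (1 <= t <= T)%N ->
    measurable_fun setT (fun w => bonus L alpha t w k * p t w k).
  by move=> tT; apply: measurable_funM; [exact: mb|exact: mp].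
have mba t k : (1 <= t <= T)%N ->
    measurable_fun setT (fun w => bonus L alpha t w k * (alpha t w k)%:R).
  by move=> tT; apply: measurable_funM; [exact: mb|exact: ma].
have mBp : measurable_fun setT Bp.
  by apply: measurable_sum_nat => t tT; apply: measurable_sum => k; exact: mbp.
have mBa : measurable_fun setT Ba.
  by apply: measurable_sum_nat => t tT; apply: measurable_sum => k; exact: mba.
have mZ t k l : (1 <= t <= T)%N -> measurable_fun setT (expmart alpha W E k l t).
  move=> tT; apply: measurable_expmart => tau /(lt_le _ _ tT).
    exact: ma.
  exact: maW.
have mZs : measurable_fun setT Z.
  apply: measurable_sum_nat => t tT.
  by do 3![apply: measurable_sum => ?]; exact: mZ.
have Z0 w : 0 <= Z w.
  by do 4![apply: sumr_ge0 => ? _]; exact: expR_ge0.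
have Bp0 w : 0 <= Bp w.
  rewrite /Bp big_nat; apply: sumr_ge0 => t tT; apply: sumr_ge0 => k _.
  by rewrite mulr_ge0// p0.
have Ba0 w : 0 <= Ba w.
  by do 2![apply: sumr_ge0 => ? _]; rewrite mulr_ge0.
(* The bonus depends only on the count, whose level sets belong to the history; on them [p]
   integrates to the probability of playing [k]. *)
have intBp : (\int[P]_w (Bp w)%:E = \int[P]_w (Ba w)%:E)%E.
  rewrite !ge0_integral_sum_nat.
  - apply: eq_big_nat => t tT; rewrite !ge0_integral_sum_EFin.
    + apply: eq_bigr => k _.
      have := @integral_mul_cond_prob R _ _ P (fun w => ncount alpha t w k) t
        (fun v => Num.sqrt (2 * L / (maxn 1 v)%:R)) [set w | alpha t w k]
        (fun w => p t w k).
      move=> ->.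
      * apply: eq_integral => w _; congr (_ * _)%:E.
        rewrite indicE; congr (nat_of_bool _)%:R.
        by apply/idP/idP => [/set_mem//|aw]; apply: mem_set.
      * by move=> w; apply: ncount_lt; case/andP: tT.
      * by move=> v; exact: mN.
      * exact: mA.
      * exact: mp.
      * by move=> w; exact: p0.
      * by move=> v; exact: sqrtr_ge0.
      * move=> v; apply: condp => //.
        apply: (@measurable_ncount_eq R _ (g_sigma_algebraType
          (hist_gen alpha W t t)) n alpha t k v) => tau.
        exact: hist_measurable_action.
    + by move=> k; exact: mba.
    + by move=> k w; rewrite mulr_ge0.
    + by move=> k; exact: mbp.
    + by move=> k w; rewrite mulr_ge0// p0.
  - by move=> t tT; apply: measurable_sum => k; exact: mba.
  - by move=> t w tT; apply: sumr_ge0 => k _; rewrite mulr_ge0.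
  - by move=> t tT; apply: measurable_sum => k; exact: mbp.
  - by move=> t w tT; apply: sumr_ge0 => k _; rewrite mulr_ge0// p0.
have intBa : (\int[P]_w (Ba w)%:E <=
    (n%:R * (Num.sqrt (2 * L) * (2 * Num.sqrt T%:R)))%:E)%E.
  apply: integral_const_le => // w; rewrite Ba0/=.
  by apply: sum_bonus_le; exact: ltW.
(* There are [2 n T^2] processes, each of mean at most 1. *)
have intZ : (\int[P]_w (Z w)%:E <= (T%:R * (n%:R * (T%:R * 2)))%:E)%E.
  rewrite ge0_integral_sum_nat.
  - have -> : T%:R * (n%:R * (T%:R * 2)) =
        \sum_(1 <= t < T.+1) \sum_(k < n) \sum_(s < T) \sum_(b : bool) (1 : R).
      rewrite !sumr_const !card_ord card_bool big_const_nat subn1/= iter_addr_0.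
      by rewrite -!mulrnA -!natrM; congr _%:R; ring.
    rewrite -sumEFin big_nat_cond [leRHS]big_nat_cond; apply: lee_sum => t.
    rewrite andbT => tT; rewrite ge0_integral_sum_EFin.
    + rewrite -sumEFin; apply: lee_sum => k _; rewrite ge0_integral_sum_EFin.
      * rewrite -sumEFin; apply: lee_sum => s _; rewrite ge0_integral_sum_EFin.
        - rewrite -sumEFin; apply: lee_sum => b _.
          (* The supermartingale bound is stated at a successor index. *)
          case: t tT => // t tT.
          apply: (@integral_expmart_le1 R _ _ P n T) => // [t' t'T|t' t'T|t' t'T|].
          + exact: ma.
          + exact: mW.
          + exact: subg.
          + exact: ltnW.
        - by move=> b; exact: mZ.
        - by move=> b w; exact: expR_ge0.
      * by move=> s; apply: measurable_sum => b; exact: mZ.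
      * by move=> s w; apply: sumr_ge0 => b _; exact: expR_ge0.
    + by move=> k; do 2![apply: measurable_sum => ?]; exact: mZ.
    + by move=> k w; do 2![apply: sumr_ge0 => ? _]; exact: expR_ge0.
  - by move=> t tT; do 3![apply: measurable_sum => ?]; exact: mZ.
  - by move=> t w tT; do 3![apply: sumr_ge0 => ? _]; exact: expR_ge0.
pose A0 := n%:R * D * Num.sqrt T%:R.
pose K := T%:R * (r%:R * C) / expR L.
have D0 : 0 < D by rewrite /D; have := lt_le_trans C0 CL; lra.
have A00 : 0 <= A0 by rewrite !mulr_ge0 ?sqrtr_ge0// ltW.
have K0 : 0 <= K by rewrite divr_ge0 ?expR_ge0// !mulr_ge0// ltW.
have bound : (\int[P]_w (\sum_(1 <= t < T.+1) (fmaximin m r E - X t w))%:E <=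
    \int[P]_w (A0 + 2 * Bp w + K * Z w)%:E)%E.
  apply: ge0_le_integral => //.
  - move=> w _; rewrite lee_fin big_nat; apply: sumr_ge0 => t tT.
    by rewrite subr_ge0; have /andP[] := X0c t w tT.
  - apply/measurable_EFinP; apply: measurable_sum_nat => t tT.
    by apply: measurable_funB => //; exact: mX.
  - apply/measurable_EFinP; apply: measurable_funD; last exact: measurable_funM.
    by apply: measurable_funD => //; exact: measurable_funM.
  - move=> w _; rewrite lee_fin.
    apply: (@ucb_regret_pointwise R Om n m r T C L E W alpha p x w) => // t tT.
    + exact: Ip.
    + exact: xmin.
    + exact: projp.
have -> : (\sum_(1 <= t < T.+1)
      ((fmaximin m r E)%:E - 'E_P[fun w => fworst m r E (p t w)]) =
    \int[P]_w (\sum_(1 <= t < T.+1) (fmaximin m r E - X t w))%:E)%E.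
  rewrite ge0_integral_sum_nat.
  - apply: eq_big_nat => t tT; rewrite unlock.
    by apply: integral_bounded_compl => [|w]; [exact: mX|exact: X0c].
  - by move=> t tT; apply: measurable_funB => //; exact: mX.
  - by move=> t w tT; rewrite subr_ge0; have /andP[] := X0c t w tT.
apply: le_trans bound _.
have -> : (\int[P]_w (A0 + 2 * Bp w + K * Z w)%:E =
    A0%:E + 2%:E * \int[P]_w (Bp w)%:E + K%:E * \int[P]_w (Z w)%:E)%E.
  under eq_integral do rewrite !EFinD !EFinM.
  have mBpE : measurable_fun setT (fun w => (Bp w)%:E) by exact/measurable_EFinP.
  have mZE : measurable_fun setT (fun w => (Z w)%:E) by exact/measurable_EFinP.
  have mBpE2 : measurable_fun setT (fun w => (2%:E * (Bp w)%:E)%E).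
    exact: measurable_funeM.
  rewrite ge0_integralD//; first rewrite ge0_integralD//.
  - rewrite integral_cst//= probability_setT mule1.
    by rewrite !ge0_integralZl_EFin// => w _; rewrite lee_fin.
  - by move=> w _; rewrite -EFinM lee_fin mulr_ge0.
  - by move=> w _; rewrite -EFinM -EFinD lee_fin addr_ge0// mulr_ge0.
  - exact: emeasurable_funD.
  - by move=> w _; rewrite -EFinM lee_fin mulr_ge0.
  - exact: measurable_funeM.
rewrite intBp.
apply: (@le_trans _ _ (A0%:E
    + 2%:E * (n%:R * (Num.sqrt (2 * L) * (2 * Num.sqrt T%:R)))%:E
    + K%:E * (T%:R * (n%:R * (T%:R * 2)))%:E)%E).
  by do !apply: leeD => //; apply: lee_wpmul2l.
rewrite -!EFinM -!EFinD lee_fin; apply: lerD; first apply: lerD => //.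
  (* [1 <= r] allows the factor [r] under the root. *)
  have sT : Num.sqrt (2 * L) * Num.sqrt T%:R <= Num.sqrt (2 * r%:R * T%:R * L).
    rewrite -sqrtrM; last by rewrite mulr_ge0// ltW.
    rewrite ler_wsqrtr//.
    have r1 : 1 <= r%:R :> R by rewrite ler1n; case/andP: r0n.
    have -> : 2 * r%:R * T%:R * L = 2 * L * T%:R * r%:R by ring.
    by rewrite ler_peMr// !mulr_ge0// ltW.
  have -> : 2 * (n%:R * (Num.sqrt (2 * L) * (2 * Num.sqrt T%:R))) =
    4 * n%:R * (Num.sqrt (2 * L) * Num.sqrt T%:R) by ring.
  by rewrite ler_wpM2l// mulr_ge0.
(* The choice of [L] makes [expR L] equal to [2 n r C T^3 (T + 1)], which cancels everything but
   [T + 1]. *)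
have -> : K * (T%:R * (n%:R * (T%:R * 2))) = (T%:R + 1)^-1.
  rewrite /K expL; field.
  by rewrite !gt_eqF//; lra.
by rewrite invf_le1; lra.
Qed.
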